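(* Let $u\in\mathcal{F}_{\mathrm N}(\mathbb{R})\cap\mathcal{F}_{\mathrm C}(\mathbb{R})$, put $l=u(u^-(0))$, $r=u(u^+(0))$, and for $p>0$ let $v_p$ be the fuzzy number $$v_p(t)=\begin{cases}1-(t/p)^2, & t\in[-p\sqrt{1-l},\,p\sqrt{1-r}],\\ 0,& t\notin[-p\sqrt{1-l},\,p\sqrt{1-r}].\end{cases}$$ Then for every positive integer $n$, $d_\infty(u\nabla v_{1/n},u)\le 1/n$. Consequently the sequence of smooth fuzzy numbers $\{u\nabla v_{1/n}\}_{n\in\mathbb{N}}\subset\mathcal{F}_{\mathrm D}(\mathbb{R})$ approximates (converges to) $u$ in the supremum metric $d_\infty$.
   Context: A fuzzy number is a map $u:\mathbb{R}\to[0,1]$ such that, writing $[u]_\alpha=\{x:u(x)\ge\alpha\}$ for $\alpha\in(0,1]$ and $[u]_0=\overline{\{x:u(x)>0\}}$, the set $[u]_1$ is nonempty and each $[u]_\alpha=[u^-(\alpha),u^+(\alpha)]$, $\alpha\in[0,1]$, is a compact interval. $\mathcal{F}(\mathbb{R})$ is the set of all fuzzy numbers. $\mathcal{F}_{\mathrm N}(\mathbb{R})$: fuzzy numbers differentiable on $(u^-(0),u^-(1))\cup(u^+(1),u^+(0))$. $\mathcal{F}_{\mathrm C}(\mathbb{R})$: fuzzy numbers $u$ continuous on $[u]_0$ (i.e. the restriction to $[u]_0$ is continuous). $\mathcal{F}_{\mathrm D}(\mathbb{R})$: those $u\in\mathcal{F}_{\mathrm C}(\mathbb{R})$ differentiable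 on $(u^-(0),u^+(0))$; its elements are called smooth fuzzy numbers. The sup-min convolution is $(u\nabla v)(x)=\sup_{y\in\mathbb{R}}\min\{u(y),v(x-y)\}$; it is a fuzzy number with $[u\nabla v]_\alpha=[u]_\alpha+[v]_\alpha$. The supremum metric is $d_\infty(u,v)=\sup_{\alpha\in[0,1]}\max\{|u^-(\alpha)-v^-(\alpha)|,|u^+(\alpha)-v^+(\alpha)|\}$. *)

(* Defs.v *)
From HB Require Import structures.
From mathcomp Require Import all_boot all_order all_algebra.
From mathcomp Require Import all_classical all_reals all_analysis.
Set Implicit Arguments.
Unset Strict Implicit.
Unset Printing Implicit Defensive.
Import Order.TTheory GRing.Theory Num.Theory.
Import numFieldNormedType.Exports.
Local Open Scope classical_set_scope.
Local Open Scope ring_scope.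

Section FuzzyNumbers.
Variable R : realType.
Implicit Types (u v : R -> R) (alpha p x : R).

(* [u]_alpha; only used for alpha in [0, 1]. *)
Definition level u alpha : set R :=
  if alpha == 0 then closure [set x | 0 < u x] else [set x | alpha <= u x].

(* The endpoints u^-(alpha) and u^+(alpha). *)
Definition lend u alpha : R := inf (level u alpha).
Definition rend u alpha : R := sup (level u alpha).

(* Since [u]_1 is nonempty, so is every [u]_alpha, and the last clause says
   that it is a (possibly degenerate) compact interval. *)
Definition fuzzy_number : set (R -> R) := [set u |
  [/\ forall x, 0 <= u x <= 1,
      level u 1 !=set0 &
      forall alpha, 0 <= alpha <= 1 ->
        level u alpha = `[lend u alpha, rend u alpha]%classic ] ].

Definition fuzzyN : set (R -> R) := [set u | fuzzy_number u /\
  forall x, (`]lend u 0, lend u 1[ `|` `]rend u 1, rend u 0[)%classic x ->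
    derivable u x 1].

Definition fuzzyC : set (R -> R) := [set u | fuzzy_number u /\
  {within level u 0, continuous u}].

Definition fuzzyD : set (R -> R) := [set u | fuzzyC u /\
  forall x, `]lend u 0, rend u 0[%classic x -> derivable u x 1].

Definition supmin u v : R -> R :=
  fun x => sup [set Num.min (u y) (v (x - y)) | y in [set: R]].

(* The set is bounded when u and v are fuzzy numbers, as all their levels are
   included in the compact 0-levels. *)
Definition dinfty u v : R :=
  sup [set Num.max `|lend u alpha - lend v alpha| `|rend u alpha - rend v alpha|
      | alpha in `[0, 1]%classic].

Definition vfun (l r p : R) : R -> R := fun t =>
  if t \in `[- (p * Num.sqrt (1 - l)), p * Num.sqrt (1 - r)]
  then 1 - (t / p) ^+ 2 else 0.

End FuzzyNumbers.

(* Main.v *)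
Require Import Defs.
From mathcomp Require Import all_boot all_order all_algebra.
From mathcomp Require Import all_classical all_reals all_analysis.
From mathcomp Require Import lra ring.
Import Order.TTheory GRing.Theory Num.Theory.
Import numFieldNormedType.Exports.
Local Open Scope classical_set_scope.
Local Open Scope ring_scope.

(* Endpoints of levels add under sup-min convolution, so with w = u \nabla v_p the
   endpoints of [w]_al and [u]_al differ by those of [v_p]_al, which lie in [-p, p].
   On the left branch w = u \o g^-1 with g y = y - p * sqrt (1 - u y); since u is
   nondecreasing, g' >= 1 and w is differentiable there (the right branch follows by
   the reflection x -> -x). At a point x of the core [u]_1 the parabola v_p gives
   1 - (h / p)^2 <= w (x + h) <= 1, so the derivative of w exists and is 0. *)

(** * Levels and sup-min convolution of fuzzy numbers *)

Lemma closure_dist {R : realType} (A : set R) (x : R) :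
  closure A x <-> forall e, 0 < e -> exists2 y, A y & `|x - y| < e.
Proof.
split=> [cA e e0|dA B /nbhs_ballP[e /= e0 eB]].
  by have [y [Ay xy]] := cA _ (nbhsx_ballx x e e0); exists y.
by have [y Ay xy] := dA e e0; exists y; split => //; exact: eB.
Qed.

Lemma level_gt0 {R : realType} (u : R -> R) (al : R) :
  0 < al -> level u al = [set x | al <= u x].
Proof. by move=> al0; rewrite /level gt_eqF. Qed.

Lemma level0 {R : realType} (u : R -> R) : level u 0 = closure [set x | 0 < u x].
Proof. by rewrite /level eqxx. Qed.

Lemma level0_gt0 {R : realType} (u : R -> R) (x : R) : 0 < u x -> level u 0 x.
Proof. by rewrite level0 => ux; exact: subset_closure. Qed.

Lemma level_le {R : realType} (u : R -> R) (al be : R) :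
  0 <= al <= be -> level u be `<=` level u al.
Proof.
case/andP; rewrite le_eqVlt => /predU1P[<-|al0] ab x.
  move: ab; rewrite le_eqVlt => /predU1P[<-//|be0].
  by rewrite level_gt0// => bx; apply: level0_gt0; exact: lt_le_trans bx.
by rewrite !level_gt0// /=; [exact: le_trans|exact: lt_le_trans ab].
Qed.

(** Common entry point for the convolution, the parabolas and reflections: exhibiting each level as
    an explicit interval gives the axioms and the endpoints at once. [A al <= B al] makes the
    interval nonempty, so that [inf] and [sup] return its ends. *)
Lemma fuzzy_of_level {R : realType} (f A B : R -> R) :
  (forall x, 0 <= f x <= 1) ->
  (forall al : R, 0 <= al <= 1 -> A al <= B al /\ level f al = `[A al, B al]%classic) ->
  fuzzy_number f /\ forall al : R, 0 <= al <= 1 -> lend f al = A al /\ rend f al = B al.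
Proof.
move=> f01 fl.
have E al : 0 <= al <= 1 -> lend f al = A al /\ rend f al = B al.
  move=> al01; have [AB lE] := fl _ al01.
  by rewrite /lend /rend lE inf_itvcc// sup_itvcc.
split => //; split => //.
  have [|AB ->] := fl 1; first by rewrite ler01 lexx.
  by exists (A 1); rewrite /= in_itv/= lexx.
by move=> al al01; have [-> ->] := E _ al01; have [] := fl _ al01.
Qed.

Lemma fuzzy_levelP {R : realType} (u : R -> R) (al x : R) :
  fuzzy_number u -> 0 <= al <= 1 ->
  level u al x <-> lend u al <= x <= rend u al.
Proof. by case=> _ _ /[apply] {1}->; rewrite /= in_itv. Qed.

Lemma fuzzy_geP {R : realType} (u : R -> R) (al x : R) :
  fuzzy_number u -> 0 < al <= 1 ->
  al <= u x <-> lend u al <= x <= rend u al.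
Proof.
move=> fu /andP[al0 al1]; rewrite -(fuzzy_levelP _ _ _ fu) ?level_gt0//.
by rewrite (ltW al0).
Qed.

Lemma lend_le_rend {R : realType} (u : R -> R) (al : R) :
  fuzzy_number u -> 0 <= al <= 1 -> lend u al <= rend u al.
Proof.
move=> fu al01; have [_ [x u1x] _] := fu.
have /(fuzzy_levelP _ _ _ fu al01) : level u al x by exact: level_le u1x.
by case/andP; exact: le_trans.
Qed.

Lemma lend_mono {R : realType} (u : R -> R) (al be : R) :
  fuzzy_number u -> 0 <= al <= be -> be <= 1 -> lend u al <= lend u be.
Proof.
move=> fu /[dup] /andP[al0 ab] /level_le L b1.
have be01 : 0 <= be <= 1 by rewrite b1 (le_trans al0).
have /L : level u be (lend u be) by apply/fuzzy_levelP; rewrite ?lexx ?lend_le_rend.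
by move/(fuzzy_levelP _ _ _ fu); rewrite al0 (le_trans ab)// => /(_ isT)/andP[].
Qed.

Lemma rend_mono {R : realType} (u : R -> R) (al be : R) :
  fuzzy_number u -> 0 <= al <= be -> be <= 1 -> rend u be <= rend u al.
Proof.
move=> fu /[dup] /andP[al0 ab] /level_le L b1.
have be01 : 0 <= be <= 1 by rewrite b1 (le_trans al0).
have /L : level u be (rend u be) by apply/fuzzy_levelP; rewrite ?lexx ?lend_le_rend.
by move/(fuzzy_levelP _ _ _ fu); rewrite al0 (le_trans ab)// => /(_ isT)/andP[].
Qed.

Lemma supmin_ge {R : realType} (u v : R -> R) (y x : R) :
  fuzzy_number u -> Num.min (u y) (v (x - y)) <= supmin u v x.
Proof.
move=> [u01 _ _]; apply: ub_le_sup; last by exists y.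
by exists 1 => _ [z _ <-]; rewrite ge_min; have /andP[_ ->] := u01 z.
Qed.

Lemma supmin_le {R : realType} (u v : R -> R) (x M : R) :
  (forall y, Num.min (u y) (v (x - y)) <= M) -> supmin u v x <= M.
Proof.
by move=> H; apply: ge_sup; [exists (Num.min (u 0) (v (x - 0))), 0|move=> _ [y _ <-]].
Qed.

(** Strict inequality needs no attainment: a supremum exceeds [M] exactly when some element does.
    The non-strict version below needs compactness. *)
Lemma supmin_gtP {R : realType} (u v : R -> R) (x M : R) : fuzzy_number u ->
  M < supmin u v x <-> exists y, M < u y /\ M < v (x - y).
Proof.
move=> fu; split=> [lt|[y [uy vy]]].
  have [|_ [y _ <-]] := sup_gt _ lt; first by exists (Num.min (u 0) (v (x - 0))), 0.
  by rewrite lt_min => /andP[? ?]; exists y.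
by apply: lt_le_trans (supmin_ge _ _ y _ fu); rewrite lt_min uy.
Qed.

(* The left ends of the nested compact intervals [u]_be `&` (x - [v]_be), be < al,
   have a supremum y lying in all of them. *)
Lemma supmin_geP {R : realType} (u v : R -> R) (x al : R) :
  fuzzy_number u -> fuzzy_number v -> 0 < al <= 1 ->
  al <= supmin u v x <-> exists y, al <= u y /\ al <= v (x - y).
Proof.
move=> fu fv /andP[al0 al1]; split=> [le|[y [uy vy]]]; last first.
  by apply: le_trans (supmin_ge _ _ y _ fu); rewrite le_min uy.
pose L be := Num.max (lend u be) (x - rend v be).
pose U be := Num.min (rend u be) (x - lend v be).
(* A witness at the higher of the two levels lies in both intersections, hence separates any left
   end from any right end. *)
have LU be ga : 0 < be < al -> 0 < ga < al -> L be <= U ga.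
  move=> /andP[be0 bal] /andP[ga0 gal].
  have m0 : 0 < Num.max be ga by rewrite lt_max be0.
  have ml : Num.max be ga < al by rewrite gt_max bal.
  have m1 : Num.max be ga <= 1 by rewrite (le_trans (ltW ml)).
  have bm : be <= Num.max be ga by rewrite le_max lexx.
  have gm : ga <= Num.max be ga by rewrite le_max lexx orbT.
  have [|y [/ltW uy /ltW vy]] := (supmin_gtP u v x (Num.max be ga) fu).1.
    exact: lt_le_trans le.
  have be1 : 0 < be <= 1 by rewrite be0 (le_trans bm).
  have ga1 : 0 < ga <= 1 by rewrite ga0 (le_trans gm).
  have /(fuzzy_geP u be y fu be1)/andP[uyl _] := le_trans bm uy.
  have /(fuzzy_geP u ga y fu ga1)/andP[_ uyr] := le_trans gm uy.
  have /(fuzzy_geP v be _ fv be1)/andP[_ vyr] := le_trans bm vy.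
  have /(fuzzy_geP v ga _ fv ga1)/andP[vyl _] := le_trans gm vy.
  by rewrite ge_max !le_min; apply/andP; split; apply/andP; split; lra.
have in01 be : 0 < be < al -> 0 < be <= 1.
  by case/andP=> -> /ltW/le_trans; exact.
pose S := [set L be | be in [set be | 0 < be < al]].
have h2 : 0 < al / 2 < al by apply/andP; split; lra.
have inLU be : 0 < be < al -> L be <= sup S <= U be.
  move=> bal; apply/andP; split.
    apply: ub_le_sup; last by exists be.
    by exists (U be) => _ [ga /= gal <-]; exact: LU.
  apply: ge_sup; first by exists (L (al / 2)), (al / 2).
  by move=> _ [ga /= gal <-]; exact: LU.
have limal (t : R) : (forall be, 0 < be < al -> be <= t) -> al <= t.
  move=> H; rewrite leNgt; apply/negP => tal.
  (* This makes the midpoint of [t] and [al] positive, hence an admissible level, and it exceeds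
     [t]. *)
  have t0 : al / 2 <= t by exact: H.
  have := H ((t + al) / 2); have -> : 0 < (t + al) / 2 < al by apply/andP; split; lra.
  by move=> /(_ isT); lra.
exists (sup S); split; apply: limal => be bal; have b01 := in01 _ bal;
  have := inLU _ bal; rewrite /L /U ge_max le_min => /andP[/andP[? ?] /andP[? ?]];
  apply/(fuzzy_geP _ _ _ _ b01) => //; apply/andP; split; lra.
Qed.

(** Only one summand moves at first: [y] is shifted towards [x - z] until it hits an end of its
    interval, and the other summand absorbs what remains. Neither moves further than the distance
    from [y + z] to [x]. *)
Lemma itv_sum {R : realType} (a b s t y z x : R) :
  a <= y <= b -> s <= z <= t -> a + s <= x <= b + t ->
  exists y', [/\ a <= y' <= b, s <= x - y' <= t, `|y' - y| <= `|x - (y + z)| &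
    `|x - y' - z| <= `|x - (y + z)|].
Proof.
move=> /andP[ay yb] /andP[sz zt] /andP[lx xr].
have [yx|xy] := leP (y + z) x.
  have -> : `|x - (y + z)| = x - (y + z) by rewrite ger0_norm//; lra.
  have [h|h] := leP (x - z) b; [exists (x - z)|exists b];
    split; rewrite ?ler_norml; apply/andP; split; lra.
have -> : `|x - (y + z)| = y + z - x by rewrite ltr0_norm; lra.
have [h|h] := leP a (x - z); [exists (x - z)|exists a];
  split; rewrite ?ler_norml; apply/andP; split; lra.
Qed.

Lemma supmin_fuzzy {R : realType} (u v : R -> R) :
  fuzzy_number u -> fuzzy_number v -> fuzzy_number (supmin u v) /\
  forall al : R, 0 <= al <= 1 -> lend (supmin u v) al = lend u al + lend v al /\
    rend (supmin u v) al = rend u al + rend v al.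
Proof.
move=> fu fv; have [u01 _ _] := fu; have [v01 _ _] := fv.
apply: (fuzzy_of_level _ (fun al => lend u al + lend v al)
  (fun al => rend u al + rend v al)) => [x|al al01].
  apply/andP; split.
    apply: le_trans (supmin_ge _ _ 0 _ fu); rewrite le_min.
    by have /andP[-> _] := u01 0; have /andP[-> _] := v01 (x - 0).
  by apply: supmin_le => y; rewrite ge_min; have /andP[_ ->] := u01 y.
split; first by rewrite lerD ?lend_le_rend.
have lu := lend_le_rend u al fu al01; have lv := lend_le_rend v al fv al01.
(* Start from the sum of the two left ends and move it to [x]. *)
have split_sum x : lend u al + lend v al <= x <= rend u al + rend v al ->
    exists y, level u al y /\ level v al (x - y).
  move=> xlr; have [||y [? ? _ _]] := itv_sum _ _ _ _ (lend u al) (lend v al) x _ _ xlr.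
  - by rewrite lexx.
  - by rewrite lexx.
  - by exists y; split; apply/fuzzy_levelP.
apply/seteqP; split => x /=; rewrite in_itv/=; have /andP[al0 al1] := al01;
  have /predU1P[a0|a0] : (0 == al) || (0 < al) by rewrite -le_eqVlt.
(* Level 0 is a closure: a closed interval containing the support of the convolution contains it. *)
- subst al; rewrite level0.
  suff sub : [set x | 0 < supmin u v x] `<=`
      `[lend u 0 + lend v 0, rend u 0 + rend v 0]%classic.
    by move=> /(closureS sub); rewrite -(closure_id _).1 /= ?in_itv//; exact: itv_closed.
  move=> {}x /= /(supmin_gtP _ _ _ _ fu)[y [/level0_gt0 + /level0_gt0]].
  move=> /(fuzzy_levelP _ _ _ fu al01)/andP[? ?].
  by move=> /(fuzzy_levelP _ _ _ fv al01)/andP[? ?]; rewrite in_itv/=; apply/andP; split; lra.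
- have al01' : 0 < al <= 1 by rewrite a0.
  rewrite level_gt0//= => /(supmin_geP _ _ _ _ fu fv al01')[y [+ +]].
  move=> /(fuzzy_geP _ _ _ fu al01')/andP[? ?] /(fuzzy_geP _ _ _ fv al01')/andP[? ?].
  by apply/andP; split; lra.
(* Conversely, both summands are approximated within [e / 2] by points of the supports, whose sum
   lies in the support of the convolution. *)
- move=> /split_sum[y [+ +]]; subst al; rewrite !level0 => /closure_dist uy /closure_dist vy.
  apply/closure_dist => e e0.
  have e2 : 0 < e / 2 by lra.
  have [y' /= uy' yy'] := uy _ e2; have [z' /= vz' zz'] := vy _ e2.
  exists (y' + z') => /=.
    by apply/supmin_gtP => //; exists y'; rewrite addrAC subrr add0r.
  have -> : x - (y' + z') = (y - y') + (x - y - z') by ring.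
  by apply: le_lt_trans (ler_normD _ _) _; lra.
- move=> /split_sum[y [+ +]]; rewrite !level_gt0//= => uy vy.
  by apply/supmin_geP; rewrite ?a0//; exists y.
Qed.

Lemma within_continuousP {R : realType} (A : set R) (f : R -> R) :
  {within A, continuous f} <-> forall x, A x -> forall e : R, 0 < e ->
    exists2 d : R, 0 < d & forall y, A y -> `|x - y| < d -> `|f x - f y| < e.
Proof.
split=> [/subspace_continuousP cf x Ax e e0|cf].
  have /cvgrPdist_lt/(_ _ e0)/nbhs_ballP[d /= d0 dA] := cf _ Ax.
  by exists d => // y Ay xy; exact: dA.
apply/subspace_continuousP => x Ax; apply/cvgrPdist_lt => e e0.
have [d d0 dA] := cf _ Ax _ e0; apply/nbhs_ballP; exists d => //= y xy Ay; exact: dA.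
Qed.

(* Closedness of the levels gives upper semicontinuity; lower semicontinuity
   follows by moving an optimal decomposition x = y + z inside the supports. *)
Lemma supmin_fuzzyC {R : realType} (u v : R -> R) :
  fuzzyC u -> fuzzyC v -> fuzzyC (supmin u v).
Proof.
move=> [fu /within_continuousP cu] [fv /within_continuousP cv].
have [fw wlr] := supmin_fuzzy _ _ fu fv; split => //.
have [w01 _ _] := fw.
have z01 : 0 <= (0 : R) <= 1 by apply/andP; split; lra.
apply/within_continuousP => x wx e e0; set w := supmin u v in fw wlr w01 wx *.
have [d1 d10 H1] : exists2 d : R, 0 < d & forall y, `|x - y| < d -> w y < w x + e.
  have [we1|we1] := leP (w x + e) 1; last first.
    by exists 1 => // y _; apply: le_lt_trans we1; have /andP[] := w01 y.
  have we01 : 0 < w x + e <= 1.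
    by rewrite we1 andbT; have /andP[? _] := w01 x; lra.
  have : nbhs x (~` level w (w x + e)).
    apply: open_nbhs_nbhs; split; last by rewrite level_gt0 /=; lra.
    have [_ _ ->] := fw; last by lra.
    by rewrite openC; exact: itv_closed.
  case/nbhs_ballP => d /= d0 dw; exists d => // y /dw /=.
  by rewrite level_gt0 /=; [lra|lra].
have [d2 d20 H2] : exists2 d : R, 0 < d &
    forall y, level w 0 y -> `|x - y| < d -> w x - e < w y.
  have [wx0|wx0] := leP (w x) 0.
    by exists 1 => // y _ _; have /andP[? _] := w01 y; lra.
  have wx01 : 0 < w x <= 1 by rewrite wx0; have /andP[] := w01 x.
  have [y [uy vy]] := (supmin_geP u v x (w x) fu fv wx01).1 (lexx _).
  have Ly : level u 0 y by apply: level0_gt0; lra.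
  have Lz : level v 0 (x - y) by apply: level0_gt0; lra.
  have [d d0 Hd] := cu _ Ly _ e0; have [d' d'0 Hd'] := cv _ Lz _ e0.
  exists (Num.min d d'); first by rewrite lt_min d0.
  move=> x'; rewrite distrC lt_min.
  move=> /(fuzzy_levelP _ _ _ fw z01); have [-> ->] := wlr _ z01 => Lx' /andP[xd xd'].
  have [y' [y1 y2 y3 y4]] := itv_sum _ _ _ _ _ _ _
    ((fuzzy_levelP _ _ _ fu z01).1 Ly) ((fuzzy_levelP _ _ _ fv z01).1 Lz) Lx'.
  move: y3 y4; rewrite (addrC y) subrK => y3 y4.
  apply: lt_le_trans (supmin_ge _ _ y' _ fu); rewrite lt_min; apply/andP; split.
    have := Hd y' ((fuzzy_levelP _ _ _ fu z01).2 y1).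
    rewrite distrC (le_lt_trans y3)// => /(_ isT); rewrite ltr_norml => /andP[? ?]; lra.
  have := Hd' (x' - y') ((fuzzy_levelP _ _ _ fv z01).2 y2).
  rewrite distrC (le_lt_trans y4)// => /(_ isT); rewrite ltr_norml => /andP[? ?]; lra.
exists (Num.min d1 d2); first by rewrite lt_min d10.
move=> y wy; rewrite lt_min => /andP[/H1 ? /(H2 _ wy) ?].
by rewrite ltr_norml; by apply/andP; split; lra.
Qed.

(** * The parabolic fuzzy numbers v_p *)

(** Inverts the right half of the parabola, which takes the value [x] at [p * Num.sqrt (1 - x)]. *)
Lemma le_pM_sqrt {R : realType} (p x t : R) : 0 < p -> x <= 1 -> 0 <= t ->
  (t <= p * Num.sqrt (1 - x)) = (x <= 1 - (t / p) ^+ 2).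
Proof.
move=> p0 x1 t0; rewrite mulrC -ler_pdivrMr// -ler_sqr ?nnegrE ?sqrtr_ge0 ?divr_ge0 ?(ltW p0)//.
by rewrite sqr_sqrtr ?subr_ge0//; apply/idP/idP; lra.
Qed.

Lemma pM_sqrt_itv {R : realType} (p x : R) : 0 < p -> 0 <= x ->
  0 <= p * Num.sqrt (1 - x) <= p.
Proof.
move=> p0 x0; rewrite mulr_ge0 ?sqrtr_ge0 ?(ltW p0)//=.
have : Num.sqrt (1 - x) <= Num.sqrt 1 by apply: ler_wsqrtr; lra.
by rewrite sqrtr1 => h; rewrite -[leRHS]mulr1 ler_pM2l.
Qed.

(** This symmetry reduces the estimates on [vfun] to [0 <= t]. *)
Lemma vfunN {R : realType} (l r p t : R) : vfun l r p (- t) = vfun r l p t.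
Proof.
by rewrite /vfun !in_itv/= lerN2 andbC lerNl mulNr sqrrN.
Qed.

(** On the right half, cutting the argument at [p * Num.sqrt (1 - r)] amounts to cutting the values
    at [r]. *)
Lemma vfun_ge0E {R : realType} (l r p t : R) :
  0 < p -> 0 <= l -> r <= 1 -> 0 <= t ->
  vfun l r p t = if r <= 1 - (t / p) ^+ 2 then 1 - (t / p) ^+ 2 else 0.
Proof.
move=> p0 l0 r1 t0; rewrite /vfun in_itv/= -le_pM_sqrt//.
suff -> : - (p * Num.sqrt (1 - l)) <= t by [].
by have /andP[? _] := pM_sqrt_itv p l p0 l0; lra.
Qed.

Lemma vfun01 {R : realType} (l r p t : R) : 0 < p -> 0 <= l <= 1 -> 0 <= r <= 1 ->
  0 <= vfun l r p t <= 1.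
Proof.
move=> p0; wlog t0 : t l r / 0 <= t => [H|/andP[l0 l1] /andP[r0 r1]].
  have [t0|t0] := leP 0 t; first exact: H.
  by rewrite -vfunN => l01 r01; apply: H => //; lra.
rewrite vfun_ge0E//; case: ifP => [h|_]; last by rewrite lexx ler01.
by rewrite (le_trans r0 h) lerBlDr lerDl sqr_ge0.
Qed.

(** The maxima reflect the truncation: at the ends of its interval the parabola has come down only
    to [l] and [r], so an end of the level stays fixed once [al] is below that value. *)
Lemma vfun_geP {R : realType} (l r p al t : R) :
  0 < p -> 0 <= l <= 1 -> 0 <= r <= 1 -> 0 < al <= 1 ->
  (al <= vfun l r p t) = (- (p * Num.sqrt (1 - Num.max al l)) <= t
    <= p * Num.sqrt (1 - Num.max al r)).
Proof.
move=> p0; wlog t0 : t l r / 0 <= t => [H|/andP[l0 l1] /andP[r0 r1] /andP[al0 al1]].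
  have [t0|t0] := leP 0 t; first exact: H.
  move=> l01 r01 al01; rewrite -vfunN H//; last lra.
  by rewrite lerN2 lerNl andbC.
have -> /= : - (p * Num.sqrt (1 - Num.max al l)) <= t.
  have m0 : 0 <= Num.max al l by rewrite le_max l0 orbT.
  by have /andP[? _] := pM_sqrt_itv _ _ p0 m0; lra.
rewrite le_pM_sqrt ?ge_max ?al1// vfun_ge0E//.
by case: ifP; rewrite ?andbT// andbF => _; apply/negbTE; rewrite -ltNge.
Qed.

Lemma vfun_gt0_near {R : realType} (l r p t e : R) :
  0 < p -> 0 <= l <= 1 -> 0 <= r <= 1 ->
  - (p * Num.sqrt (1 - l)) <= t <= p * Num.sqrt (1 - r) -> 0 < e ->
  exists2 y, 0 < vfun l r p y & `|t - y| < e.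
Proof.
move=> p0; wlog t0 : t l r / 0 <= t => [H|/andP[l0 l1] /andP[r0 r1]].
  have [t0|t0] := leP 0 t; first exact: H.
  move=> l01 r01 tlr e0; have [||y vy ty] := H (- t) r l _ r01 l01 _ e0.
  - lra.
  - by rewrite lerN2 lerNl andbC.
  by exists (- y); [rewrite vfunN|rewrite opprK -normrN opprD].
case/andP=> _; rewrite le_pM_sqrt// => rq e0.
have [->|tn0] := eqVneq t 0.
  exists 0; last by rewrite subr0 normr0.
  by rewrite vfun_ge0E// mul0r expr0n/= subr0 r1.
have {tn0}t0 : 0 < t by rewrite lt_neqAle eq_sym tn0.
(* When [r = 0] the parabola vanishes at the end of its interval. A step towards 0, stopped at 0,
   makes it strictly greater than [r]. *)
pose y := Num.max 0 (t - e / 2).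
have y0 : 0 <= y by rewrite le_max lexx.
have yt : y < t by rewrite gt_max t0; lra.
exists y.
  have : (y / p) ^+ 2 < (t / p) ^+ 2.
    by rewrite ltr_pXn2r ?nnegrE ?divr_ge0 ?ltr_pM2r ?invr_gt0//; exact: ltW.
  by move=> yt2; rewrite vfun_ge0E// ifT; lra.
rewrite gtr0_norm ?subr_gt0// ltrBlDl -ltrBlDr lt_max; apply/orP; right; lra.
Qed.

Lemma vfun_fuzzy {R : realType} (l r p : R) :
  0 < p -> 0 <= l <= 1 -> 0 <= r <= 1 -> fuzzy_number (vfun l r p) /\
  forall al : R, 0 <= al <= 1 ->
    lend (vfun l r p) al = - (p * Num.sqrt (1 - Num.max al l)) /\
    rend (vfun l r p) al = p * Num.sqrt (1 - Num.max al r).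
Proof.
move=> p0 l01 r01.
apply: (fuzzy_of_level _ (fun al => - (p * Num.sqrt (1 - Num.max al l)))
  (fun al => p * Num.sqrt (1 - Num.max al r))) => [t|al /andP[al0 al1]].
  exact: vfun01.
split.
  have ml : 0 <= Num.max al l by rewrite le_max al0.
  have mr : 0 <= Num.max al r by rewrite le_max al0.
  have /andP[? _] := pM_sqrt_itv _ _ p0 ml.
  by have /andP[? _] := pM_sqrt_itv _ _ p0 mr; lra.
have /predU1P[a0|a0] : (0 == al) || (0 < al) by rewrite -le_eqVlt.
- subst al; rewrite level0; have [/andP[l0 _] /andP[r0 _]] := (l01, r01).
  rewrite (max_idPr l0) (max_idPr r0).
  apply/seteqP; split=> t /=; last first.
    by rewrite in_itv/= => tlr; apply/closure_dist => e e0; exact: vfun_gt0_near.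
  suff sub : [set x | 0 < vfun l r p x] `<=`
      `[- (p * Num.sqrt (1 - l)), p * Num.sqrt (1 - r)]%classic.
    by move=> /(closureS sub); rewrite -(closure_id _).1//; exact: itv_closed.
  by move=> {}t /=; rewrite /vfun; case: ifP => //; rewrite ltxx.
- rewrite level_gt0//; apply/seteqP; split=> t /=; rewrite in_itv/= vfun_geP ?a0//.
Qed.

(** On its 0-level [vfun] is the untruncated parabola; possible jumps at the ends are invisible in
    the subspace topology. *)
Lemma vfun_fuzzyC {R : realType} (l r p : R) :
  0 < p -> 0 <= l <= 1 -> 0 <= r <= 1 -> fuzzyC (vfun l r p).
Proof.
move=> p0 l01 r01; have [fv vlr] := vfun_fuzzy _ _ _ p0 l01 r01; split => //.
have cq : continuous (fun t : R => 1 - (t / p) ^+ 2).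
  move=> t; apply: cvgB; first exact: cvg_cst.
  rewrite expr2; under eq_fun do rewrite expr2.
  by apply: cvgM; apply: cvgM; try exact: cvg_cst; exact: cvg_id.
apply: subspace_eq_continuous (continuous_subspaceT cq) => t.
rewrite inE; have [_ _ ->] := fv; last by apply/andP; split; lra.
have [|-> ->] := vlr 0; first by apply/andP; split; lra.
have [/andP[l0 _] /andP[r0 _]] := (l01, r01).
by rewrite (max_idPr l0) (max_idPr r0) /from_subspace /vfun /= => h; rewrite ifT.
Qed.

(** * Differentiability of the convolution *)

(* On the left branch [w]_al has left end g y = y - p * sqrt (1 - u y) where
   u y = al, so w = u \o g^-1; since u is nondecreasing, g' >= 1. *)
Lemma supmin_vfun_derivable_increasing {R : realType} (u : R -> R) (a c r p : R) :
  0 < p -> 0 <= r <= 1 -> fuzzy_number u ->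
  (forall x y : R, x <= y <= c -> u x <= u y) -> u c = 1 ->
  (forall y, y < c -> u y < 1) -> {within `[a, c], continuous u} ->
  (forall y, a < y < c -> derivable u y 1) ->
  forall x : R, a <= c -> a - p * Num.sqrt (1 - u a) < x < c ->
    derivable (supmin u (vfun (u a) r p)) x 1.
Proof.
move=> p0 /andP[r0 r1] fu mono uc lt1 ucont uder x ac gx.
have [u01 _ _] := fu.
have /andP[ua0 ua1] := u01 a.
set w := supmin u _; pose g y := y - p * Num.sqrt (1 - u y).
(* In the supremum at [g y], a decomposition point [y' <= y] is controlled by [u y' <= u y]; for
   [y' > y] the argument of the parabola lies left of [- (p * Num.sqrt (1 - u y))], so its value is
   at most [u y]. Equality occurs at [y' = y], where [u a <= u y] prevents truncation. *)
have wg y : a <= y <= c -> w (g y) = u y.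
  move=> /andP[ay yc]; have /andP[uy0 uy1] := u01 y.
  have S0 : 0 <= p * Num.sqrt (1 - u y) by case/andP: (pM_sqrt_itv _ _ p0 uy0).
  have uay : u a <= u y by apply: mono; rewrite ay.
  apply/eqP; rewrite eq_le; apply/andP; split.
    apply: supmin_le => y'; have [yy|yy] := leP y' y.
      by rewrite ge_min mono ?yy.
    rewrite ge_min; apply/orP; right; rewrite -vfunN vfun_ge0E//; last by rewrite /g; lra.
    case: ifP => // _; rewrite leNgt; apply/negP => /ltW.
    by rewrite -le_pM_sqrt//; rewrite /g; lra.
  apply: le_trans (supmin_ge _ _ y _ fu); rewrite le_min lexx/=.
  rewrite -vfunN vfun_ge0E//; last by rewrite /g; lra.
  have -> : - (g y - y) / p = Num.sqrt (1 - u y) by rewrite /g; field; rewrite gt_eqF.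
  by rewrite sqr_sqrtr ?subr_ge0// opprB addrC subrK uay.
have ginc y z : y < z -> z <= c -> g y - y <= g z - z.
  move=> yz zc; have : u y <= u z by apply: mono; rewrite ltW.
  move=> uyz; have : Num.sqrt (1 - u z) <= Num.sqrt (1 - u y) by apply: ler_wsqrtr; lra.
  by rewrite -(ler_pM2l p0) /g; lra.
have gcont : {within `[a, c], continuous g}.
  have idcont : {within `[a, c], continuous (fun y : R => y)}.
    by apply: continuous_subspaceT => y; exact: cvg_id.
  move=> y; apply: cvgB; first exact: idcont.
  apply: cvgM; first exact: cvg_cst.
  apply: (@continuous_comp (subspace _) R R (fun t => 1 - u t) Num.sqrt y).
    by apply: cvgB; [exact: cvg_cst|exact: ucont].
  exact: sqrt_continuous.
have gc : g c = c by rewrite /g uc subrr sqrtr0 mulr0 subr0.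
have ivt (z : R) : g a < z < g c -> exists2 y, a < y < c & g y = z.
  move=> /andP[az zc]; have [|y] := @IVT _ g a c z ac gcont.
    by rewrite min_l ?max_r; try apply/andP; try split; lra.
  rewrite in_itv/= => /andP[ay yc] gyz; exists y => //.
  rewrite !lt_neqAle ay yc !andbT; apply/andP; split; apply/eqP => E.
    by move: az; rewrite -gyz -E ltxx.
  by move: zc; rewrite -gyz E ltxx.
(* Inverse of [g] by choice; the default [a] is returned only off the image of [[a, c]], and [ginc]
   makes preimages unique. *)
pose h z := xget a [set y | a <= y <= c /\ g y = z].
have gK y : a <= y <= c -> h (g y) = y.
  move=> yac; have [/andP[h1 h2] hg] : (a <= h (g y) <= c /\ g (h (g y)) = g y).
    by apply: (@xgetPex _ a [set z | a <= z <= c /\ g z = g y]); exists y.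
  case/andP: yac => ay yc.
  by have [lt|lt|//] := ltgtP (h (g y)) y; [have := ginc _ _ lt yc|have := ginc _ _ lt h2]; lra.
have gder y : a < y < c -> derivable g y 1.
  move=> /[dup] /uder uy /andP[ay yc]; apply: derivableB => //.
  apply: derivableM; first exact: derivable_cst.
  have uB : derivable (fun t => 1 - u t) y 1 by exact: derivableB.
  (* Strictly left of the core the square root is differentiated away from 0. *)
  have s1 : 0 < 1 - u y by rewrite subr_gt0 lt1.
  have d1 := is_derive1_sqrt s1; move/derivableP in uB.
  by have [] := @is_derive1_comp _ Num.sqrt (fun t => 1 - u t) y _ _ d1 uB.
have [y yac gyx] : exists2 y, a < y < c & g y = x by apply: ivt; rewrite gc.
have g' : 'D_1 g y != 0.
  have der2 z : derivable (fun t : R => t / 2) z 1 by apply: derivableM.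
  (* By [ginc], [g t - t] is only nondecreasing; subtracting [t / 2] instead gives a strictly
     increasing function, whence a derivative of [g] of at least 1/2. *)
  have : 0 <= derive1 (fun t => g t - t / 2) y.
    apply: (@incr_derive1_ge0_itv _ _ true true a c).
    - by move=> z; rewrite inE/= in_itv/= => zac; apply: derivableB => //; exact: gder.
    - move=> z t; rewrite !in_itv/= => /andP[? ?] /andP[? ?] zt.
      by have := ginc z t zt; lra.
    - by rewrite in_itv.
  rewrite derive1E deriveB//; last exact: gder.
  rewrite deriveM// derive_cst derive_id scaler0 add0r -[_ *: 1]/(_ * 1) mulr1 => h1; rewrite gt_eqF//; lra.
have near_ac z : a < z < c -> \forall t \near z, a < t < c.
  move=> zac; have : z \in `]a, c[ by rewrite in_itv.
  by move=> /near_in_itvoo; apply: filterS => t; rewrite in_itv.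
have hder : derivable h x 1.
  rewrite -gyx; suff : is_derive (g y) 1 h ('D_1 g y)^-1 by case.
  apply: is_derive_inverse => //; last by apply/derivableP; exact: gder.
    by apply: filterS (near_ac _ yac) => t /andP[ta tc]; apply: gK; rewrite !ltW.
  apply: filterS (near_ac _ yac) => t tac; apply: differentiable_continuous.
  by apply/derivable1_diffP; exact: gder.
have hx : h x = y by rewrite -gyx gK//; case/andP: yac => /ltW -> /ltW ->.
apply: (@near_eq_derivable _ _ _ (u \o h)).
  have : x \in `]g a, g c[ by rewrite in_itv/= gc.
  move=> /near_in_itvoo; apply: filterS => t; rewrite in_itv/= => /ivt[z zac <-].
  have zac' : a <= z <= c by case/andP: zac => /ltW -> /ltW ->.
  by rewrite /= gK// wg.
have /derivableP hd := hder.
have /derivableP ud : derivable u (h x) 1 by rewrite hx; exact: uder.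
by have [] := @is_derive1_comp _ u h x _ _ ud hd.
Qed.

Lemma fuzzy_peak {R : realType} (u : R -> R) (x : R) : fuzzy_number u ->
  (u x = 1) <-> lend u 1 <= x <= rend u 1.
Proof.
move=> fu; rewrite -fuzzy_geP//; last by rewrite ltr01 lexx.
have [u01 _ _] := fu; have /andP[_ ux1] := u01 x.
by split=> [->//|u1]; apply/eqP; rewrite eq_le ux1.
Qed.

(** If [u x > 0], the level at height [u x] is an interval containing both [x] and the core, hence
    also [y]. *)
Lemma fuzzy_nondecr {R : realType} (u : R -> R) (x y : R) : fuzzy_number u ->
  x <= y <= lend u 1 -> u x <= u y.
Proof.
move=> fu /andP[xy yc]; have [u01 _ _] := fu.
have /andP[ux0 ux1] := u01 x.
have [ux|ux] := leP (u x) 0; first by apply: le_trans ux _; case/andP: (u01 y).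
have ux01 : 0 < u x <= 1 by rewrite ux.
have /(fuzzy_geP _ _ _ fu ux01)/andP[lx _] := lexx (u x).
apply/(fuzzy_geP _ _ _ fu ux01); rewrite (le_trans lx)//=.
apply: le_trans yc _; apply: le_trans (_ : rend u 1 <= _).
  by apply: lend_le_rend => //; rewrite ler01 lexx.
by apply: rend_mono => //; rewrite ltW.
Qed.

(** Reflection exchanges the two branches, so results on the left transfer to the right. *)
Lemma fuzzyN_opp {R : realType} (u : R -> R) :
  fuzzy_number u -> fuzzy_number (fun x => u (- x)) /\
  forall al : R, 0 <= al <= 1 -> lend (fun x => u (- x)) al = - rend u al /\
    rend (fun x => u (- x)) al = - lend u al.
Proof.
move=> fu; apply: (fuzzy_of_level _ (fun al => - rend u al) (fun al => - lend u al)).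
  by move=> x; have [u01 _ _] := fu; exact: u01.
move=> al al01; rewrite lerN2 lend_le_rend//; split => //.
have -> : level (fun x => u (- x)) al = [set x | level u al (- x)].
  have [->|al0] := eqVneq al 0; last by rewrite /level (negbTE al0).
  rewrite !level0; apply/seteqP; split=> x /closure_dist cx; apply/closure_dist => e e0;
    have [y uy xy] := cx e e0; exists (- y); rewrite /= ?opprK//.
    by rewrite -normrN opprD !opprK.
  by rewrite -normrN opprD.
by apply/seteqP; split=> x /=; rewrite in_itv/= [X in _ && X]lerNr lerNl andbC;
  apply fuzzy_levelP.
Qed.

Lemma derivable_opp_arg {R : realType} (f : R -> R) (x : R) :
  derivable f (- x) 1 -> derivable (fun t => f (- t)) x 1.
Proof.
move=> /derivableP df.
have /derivableP dN : derivable (fun t : R => - t) x 1 by exact: derivableN.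
by have [] := @is_derive1_comp _ f (fun t => - t) x _ _ df dN.
Qed.

Lemma supmin_opp {R : realType} (u v : R -> R) (x : R) :
  supmin (fun y => u (- y)) (fun y => v (- y)) x = supmin u v (- x).
Proof.
rewrite /supmin; congr sup; apply/seteqP; split=> _ [y _ <-]; exists (- y) => //=;
  by congr (Num.min (u _) (v _)); ring.
Qed.

Lemma supmin_vfunN {R : realType} (u : R -> R) (l r p x : R) :
  supmin u (vfun l r p) x = supmin (fun y => u (- y)) (vfun r l p) (- x).
Proof.
have -> : vfun r l p = fun t => vfun l r p (- t) by apply/funext => t; rewrite vfunN.
by rewrite supmin_opp opprK.
Qed.

(** The increasing branch with [a = lend u 0] and [c = lend u 1]; the lower bound on [x] is the left
    end of the 0-level of the convolution. *)
Lemma supmin_vfun_derivable_left {R : realType} (u : R -> R) (r p x : R) :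
  0 < p -> 0 <= r <= 1 -> fuzzy_number u -> {within level u 0, continuous u} ->
  (forall y : R, lend u 0 < y < lend u 1 -> derivable u y 1) ->
  lend u 0 - p * Num.sqrt (1 - u (lend u 0)) < x < lend u 1 ->
  derivable (supmin u (vfun (u (lend u 0)) r p)) x 1.
Proof.
move=> p0 r01 fu uc ud xlr; have c01 : 0 <= (1 : R) <= 1 by rewrite ler01 lexx.
have lc : lend u 0 <= lend u 1 by apply: lend_mono; rewrite ?lexx ?ler01.
apply: (supmin_vfun_derivable_increasing _ _ (lend u 1)) => //.
- by move=> y z; exact: fuzzy_nondecr.
- by apply/fuzzy_peak; rewrite ?lexx ?lend_le_rend.
- move=> y yc; have [u01 _ _] := fu; have /andP[_] := u01 y.
  rewrite le_eqVlt => /predU1P[/(fuzzy_peak _ _ fu)/andP[]|//].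
  by rewrite leNgt yc.
- apply: continuous_subspaceW uc => y; rewrite /= in_itv/= => /andP[ly yc].
  apply/fuzzy_levelP; rewrite ?lexx ?ler01//= ly/= (le_trans yc)//.
  apply: le_trans (lend_le_rend _ _ fu c01) _.
  by apply: rend_mono; rewrite ?lexx ?ler01.
Qed.

Lemma supmin_vfun_derivable_right {R : realType} (u : R -> R) (l p x : R) :
  0 < p -> 0 <= l <= 1 -> fuzzy_number u -> {within level u 0, continuous u} ->
  (forall y : R, rend u 1 < y < rend u 0 -> derivable u y 1) ->
  rend u 1 < x < rend u 0 + p * Num.sqrt (1 - u (rend u 0)) ->
  derivable (supmin u (vfun l (u (rend u 0)) p)) x 1.
Proof.
move=> p0 l01 fu uc ud xlr; have [fN uN] := fuzzyN_opp _ fu.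
have [|l0 r0] := uN 0; first by rewrite lexx ler01.
have [|l1 r1] := uN 1; first by rewrite lexx ler01.
have -> : supmin u (vfun l (u (rend u 0)) p) =
    fun t => supmin (fun y => u (- y)) (vfun (u (rend u 0)) l p) (- t).
  by apply/funext => t; exact: supmin_vfunN.
apply: derivable_opp_arg.
have -> : u (rend u 0) = (fun y => u (- y)) (lend (fun x => u (- x)) 0).
  by rewrite l0 (opprK (rend u 0)).
apply: supmin_vfun_derivable_left => //.
- apply/within_continuousP => y; move/within_continuousP: uc => uc Ly e e0.
  have Ny z : level (fun x => u (- x)) 0 z -> level u 0 (- z).
    rewrite !fuzzy_levelP ?lexx ?ler01// l0 r0 => /andP[? ?].
    by apply/andP; split; lra.
  have [d d0 dL] := uc _ (Ny _ Ly) e e0; exists d => // z /Ny Lz yz.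
  by apply: dL => //; rewrite -normrN opprB opprK addrC.
- rewrite l0 l1 => y yr; apply: derivable_opp_arg; apply: ud.
  by case/andP: yr => ? ?; apply/andP; split; lra.
- by rewrite l0 l1 opprK; case/andP: xlr => ? ?; apply/andP; split; lra.
Qed.

(** The difference quotient is at most [C * |h|] in absolute value, so the derivative is 0. *)
Lemma derivable_of_quadratic {R : realType} (f : R -> R) (x C d : R) :
  0 < d -> (forall h, `|h| < d -> `|f (x + h) - f x| <= C * h ^+ 2) ->
  derivable f x 1.
Proof.
move=> d0 H; have C0 : 0 <= C.
  have d2 : `|d / 2| < d by rewrite gtr0_norm; lra.
  have := le_trans (normr_ge0 _) (H _ d2).
  by rewrite pmulr_lge0// exprn_gt0//; lra.
apply/cvg_ex; exists 0; apply/cvgrPdist_le => e e0.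
(* [C + 1] rather than [C] keeps the denominator positive when [C = 0]. *)
have k0 : 0 < Num.min d (e / (C + 1)) by rewrite lt_min d0 divr_gt0//; lra.
exists (Num.min d (e / (C + 1))) => //= h; rewrite /ball_ /= sub0r normrN lt_min => /andP[hd he] h0.
rewrite sub0r normrN normrZ normfV [h%:A]mulr1 (addrC h).
have hn0 : 0 < `|h| by rewrite normr_gt0.
rewrite mulrC ler_pdivrMr//; apply: le_trans (H h hd) _.
rewrite -real_normK ?num_real// expr2 mulrA ler_pM2r//.
move: he; rewrite ltr_pdivlMr; nra.
Qed.

(* At a point of the core, w (x + h) >= min (u x) (v h) = 1 - (h / p) ^ 2, unless
   r = 1, when x is interior to the core and w = 1 to its right. *)
Lemma supmin_vfun_core_right {R : realType} (u : R -> R) (l p x : R) :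
  0 < p -> 0 <= l <= 1 -> fuzzy_number u -> lend u 1 <= x <= rend u 1 ->
  x < rend u 0 + p * Num.sqrt (1 - u (rend u 0)) ->
  exists2 d, 0 < d & forall h, 0 <= h < d ->
    1 - (h / p) ^+ 2 <= supmin u (vfun l (u (rend u 0)) p) (x + h).
Proof.
move=> p0 /andP[l0 l1] fu xcd xB; have [u01 _ _] := fu.
set r := u (rend u 0); have /andP[r0 r1] : 0 <= r <= 1 := u01 _.
have ux1 := (fuzzy_peak _ _ fu).2 xcd.
have [r1'|r1'] := eqVneq r 1.
  have /andP[_ bd] := (fuzzy_peak _ _ fu).1 r1'.
  move: xB; rewrite -/r r1' subrr sqrtr0 mulr0 addr0 => xb.
  exists (rend u 1 - x) => [|h /andP[h0 hd]]; first by lra.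
  apply: le_trans (supmin_ge _ _ (x + h) _ fu).
  rewrite subrr vfun_ge0E// mul0r expr0n/= subr0 lexx.
  rewrite (fuzzy_peak _ _ fu).2; last by case/andP: xcd => ? ?; apply/andP; split; lra.
  by rewrite minxx lerBlDr lerDl sqr_ge0.
exists (p * Num.sqrt (1 - r)) => [|h /andP[h0 hr]].
  by rewrite mulr_gt0// sqrtr_gt0 subr_gt0 lt_neqAle r1'.
apply: le_trans (supmin_ge _ _ x _ fu); rewrite addrAC subrr add0r ux1.
rewrite vfun_ge0E// -le_pM_sqrt// (ltW hr) le_min lexx andbT.
by rewrite lerBlDr lerDl sqr_ge0.
Qed.

Lemma supmin_vfun_derivable_core {R : realType} (u : R -> R) (p x : R) :
  0 < p -> fuzzy_number u -> lend u 1 <= x <= rend u 1 ->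
  lend u 0 - p * Num.sqrt (1 - u (lend u 0)) < x <
    rend u 0 + p * Num.sqrt (1 - u (rend u 0)) ->
  derivable (supmin u (vfun (u (lend u 0)) (u (rend u 0)) p)) x 1.
Proof.
move=> p0 fu xcd /andP[xA xB]; have [u01 _ _] := fu.
set l := u (lend u 0); set r := u (rend u 0); set w := supmin u _.
have w1 t : w t <= 1 by apply: supmin_le => y; rewrite ge_min; case/andP: (u01 y) => _ ->.
have [d d0 dR] := supmin_vfun_core_right _ l _ _ p0 (u01 _) fu xcd xB.
(* The left bound is the right bound for the reflected [u] at [- x], with [l] and [r] exchanged. *)
have [d' d'0 dL] : exists2 d, 0 < d & forall h, 0 <= h < d -> 1 - (h / p) ^+ 2 <= w (x - h).
  have [fN uN] := fuzzyN_opp _ fu.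
  have [|l0 r0] := uN 0; first by rewrite lexx ler01.
  have [|l1 r1] := uN 1; first by rewrite lexx ler01.
  have [||d' d'0 H] := supmin_vfun_core_right _ r _ (- x) p0 (u01 _) fN.
  - by rewrite l1 r1 !lerN2 andbC.
  - by rewrite r0 (opprK (lend u 0)) -/l; lra.
  exists d' => // h hd; move: (H h hd); rewrite r0 (opprK (lend u 0)) -/l.
  by move=> wh; rewrite /w supmin_vfunN opprD opprK.
have wx : w x = 1.
  apply/eqP; rewrite eq_le w1/=; have := dR 0.
  by rewrite lexx d0 mul0r expr0n/= subr0 addr0; exact.
apply: (derivable_of_quadratic _ _ (p ^- 2) (Num.min d d')); first by rewrite lt_min d0.
move=> h; rewrite lt_min wx => /andP[hd hd'].
rewrite distrC ger0_norm ?subr_ge0// mulrC -expr_div_n lerBlDr addrC -lerBlDr.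
have [h0|h0] := leP 0 h; first by apply: dR; rewrite h0 -[h]ger0_norm.
have := dL (- h); rewrite opprK mulNr sqrrN; apply.
by rewrite -(ltr0_norm h0) normr_ge0.
Qed.

Lemma supmin_vfun_fuzzyD {R : realType} (u : R -> R) (p : R) :
  0 < p -> fuzzyN u -> fuzzyC u ->
  fuzzyD (supmin u (vfun (u (lend u 0)) (u (rend u 0)) p)).
Proof.
move=> p0 [fu uN] [_ uC]; have [u01 _ _] := fu.
set l := u (lend u 0); set r := u (rend u 0).
have l01 : 0 <= l <= 1 := u01 _; have r01 : 0 <= r <= 1 := u01 _.
have [fv vlr] := vfun_fuzzy _ _ _ p0 l01 r01.
split; first by apply: supmin_fuzzyC => //; exact: vfun_fuzzyC.
have [_ wlr] := supmin_fuzzy _ _ fu fv.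
have [|-> ->] := wlr 0; first by rewrite lexx ler01.
have [|-> ->] := vlr 0; first by rewrite lexx ler01.
have [/andP[l0 _] /andP[r0 _]] := (l01, r01).
rewrite (max_idPr l0) (max_idPr r0) => x; rewrite /= in_itv/= => /andP[Ax xB].
(* Differentiability of [u] is available only off the core, so the core is treated separately by the
   quadratic bound. *)
have [cx|xc] := leP (lend u 1) x; last first.
  apply: supmin_vfun_derivable_left => //; last by rewrite Ax.
  by move=> y yac; apply: uN; left; rewrite /= in_itv.
have [xd|dx] := leP x (rend u 1); last first.
  apply: supmin_vfun_derivable_right => //; last by rewrite dx.
  by move=> y ydb; apply: uN; right; rewrite /= in_itv.
by apply: supmin_vfun_derivable_core; rewrite ?cx ?Ax.
Qed.

(** * Distance in the supremum metric and convergence *)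

Lemma dinfty_supmin_vfun {R : realType} (u : R -> R) (l r p : R) :
  0 < p -> 0 <= l <= 1 -> 0 <= r <= 1 -> fuzzy_number u ->
  0 <= dinfty (supmin u (vfun l r p)) u <= p.
Proof.
move=> p0 l01 r01 fu; have [fv vlr] := vfun_fuzzy _ _ _ p0 l01 r01.
have [_ wlr] := supmin_fuzzy _ _ fu fv.
rewrite /dinfty; set D := [set _ | _ in `[0, 1]%classic].
(* The endpoints of [u] cancel, leaving those of the parabola, which lie within [p] of 0. *)
have ubD : ubound D p.
  move=> _ [al /= +] <-; rewrite in_itv/= => al01.
  have [-> ->] := wlr _ al01; have [-> ->] := vlr _ al01.
  have ml : 0 <= Num.max al l by rewrite le_max; case/andP: al01 => ->.
  have mr : 0 <= Num.max al r by rewrite le_max; case/andP: al01 => ->.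
  have /andP[? ?] := pM_sqrt_itv _ _ p0 ml; have /andP[? ?] := pM_sqrt_itv _ _ p0 mr.
  rewrite (addrAC (lend u al)) (addrAC (rend u al)) !subrr !add0r normrN.
  by rewrite !ger0_norm// ge_max; apply/andP.
have [y Dy] : D !=set0.
  by eexists; exists 0 => //; rewrite /= in_itv/= lexx ler01.
apply/andP; split; last by apply: ge_sup => //; exists y.
apply: le_trans (ub_le_sup _ Dy); last by exists p.
by case: Dy => al _ <-; rewrite le_max normr_ge0.
Qed.

Theorem theorem5p12 (R : realType) (u : R -> R)
    (hu : (@fuzzyN R `&` @fuzzyC R) u) :
  let l := u (lend u 0) in
  let r := u (rend u 0) in
  [/\ forall p : R, 0 < p -> fuzzy_number (vfun l r p),
      forall n : nat, (0 < n)%N -> fuzzyD (supmin u (vfun l r n%:R^-1)),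
      forall n : nat, (0 < n)%N ->
        dinfty (supmin u (vfun l r n%:R^-1)) u <= n%:R^-1 &
      dinfty (supmin u (vfun l r n.+1%:R^-1)) u @[n --> \oo] --> (0 : R)].
Proof.
move: hu => [uN uC] l r; have [fu _] := uN; have [u01 _ _] := fu.
have n0 (n : nat) : (0 < n)%N -> 0 < n%:R^-1 :> R by rewrite invr_gt0 ltr0n.
have dle n (n_gt0 : (0 < n)%N) := dinfty_supmin_vfun u l r _ (n0 n n_gt0) (u01 _) (u01 _) fu.
split=> [p p0|n n_gt0|n n_gt0|].
- by have [] := vfun_fuzzy l r p p0 (u01 _) (u01 _).
- by apply: supmin_vfun_fuzzyD => //; exact: n0.
- by have /andP[] := dle n n_gt0.
(* The shift to [n.+1] avoids the index 0 and matches the harmonic sequence, which squeezes the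
   distances to 0. *)
- apply: (squeeze_cvgr _ (cvg_cst 0) (@cvg_harmonic R)).
  by apply: nearW => n; exact: dle.
Qed.
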